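(* Let $\Gamma=\{X_n\}_{n\in\mathbb N_0}$ be a supermartingale adapted to a filtration $\{\mathcal F_n\}_{n\in\mathbb N_0}$ satisfying: 1. $X_0$ is a constant random variable; 2. for all $n\in\mathbb N_0$ and all $\omega$: (i) $X_n(\omega)\ge0$ and (ii) $X_n(\omega)=0$ implies $X_{n+1}(\omega)=0$; 3. there exists $\delta\in(0,\infty)$ such that for all $n\in\mathbb N_0$, a.s. $\mathbb E(|X_{n+1}-X_n|\mid\mathcal F_n)\ge\delta\cdot\mathbf 1_{X_n>0}$. Then $\mathbb P(Z_\Gamma<\infty)=1$ and the function $k\mapsto\mathbb P(Z_\Gamma\ge k)$ is in $\mathcal O\!\left(k^{-\frac16}\right)$.
   Context: All random variables live on a probability space $(\Omega,\mathcal F,\mathbb P)$; $\mathbb N_0$ is the set of nonnegative integers. Supermartingale: adapted, $\mathbb E(|X_n|)<\infty$ and $\mathbb E(X_{n+1}\mid\mathcal F_n)\le X_n$ a.s. for all $n$. The stopping time $Z_\Gamma$ is $Z_\Gamma(\omega):=\min\{n\in\mathbb N_0: X_n(\omega)\le0\}$, with $\min\emptyset:=\infty$. *)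

(* Defs.v *)
From HB Require Import structures.
From mathcomp Require Import all_boot all_order all_algebra.
From mathcomp Require Import all_classical all_reals all_analysis.

Set Implicit Arguments.
Unset Strict Implicit.
Unset Printing Implicit Defensive.

Import Order.TTheory GRing.Theory Num.Theory.
Import numFieldNormedType.Exports.

Local Open Scope classical_set_scope.
Local Open Scope ring_scope.

Section defs.
Context d (T : measurableType d) (R : realType) (P : probability T R).

Definition filtration (F : nat -> set (set T)) : Prop :=
  [/\ forall n, sigma_algebra [set: T] (F n),
      forall n, F n `<=` measurable &
      forall m n, (m <= n)%N -> F m `<=` F n].

Definition measurable_wrt (G : set (set T)) (X : T -> R) : Prop :=
  preimage_set_system [set: T] X measurable `<=` G.

(* [Y] is a version of the conditional expectation E(X | G).  For integrable X
   a version exists and is P-a.s. unique, so an a.s. statement about E(X | G)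
   is expressed below by asserting it for some version. *)
Definition is_cond_exp (G : set (set T)) (X Y : T -> R) : Prop :=
  [/\ measurable_wrt G Y,
      P.-integrable [set: T] (EFin \o Y) &
      forall A, G A ->
        (\int[P]_(w in A) (Y w)%:E = \int[P]_(w in A) (X w)%:E)%E].

Definition supermartingale (F : nat -> set (set T))
    (X : nat -> {RV P >-> R}) : Prop :=
  [/\ forall n, measurable_wrt (F n) (X n),
      forall n, P.-integrable [set: T] (EFin \o X n) &
      forall n, exists2 Y : T -> R, is_cond_exp (F n) (X n.+1) Y &
        {ae P, forall w, Y w <= X n w}].

Definition stopping_time_Z (X : nat -> {RV P >-> R}) (w : T) : \bar R :=
  if pselect (exists n, X n w <= 0) is left h then (ex_minn h)%:R%:E else +oo%E.

End defs.

(* Main.v *)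
(* Put s = delta / 4.  If X_n = x > 0 then, X being a supermartingale, the
   conditional mean of (x - X_{n+1})^+ is at least delta / 2.  Hence for every
   level t >= 0 the concave truncation E[min(X_n, t)] drops by at least
   s P(X_n > 0, t <= X_n < t + s) at step n, so the sum over n of these band
   probabilities is at most E[X_0] / s.  Covering (0, J s) by J bands and using
   Markov's inequality above J s,
     k P(Z >= k) <= sum_(n < k) P(X_n > 0) <= (E[X_0] / s) (k / J + J);
   J of order sqrt k gives P(Z >= k) = O(k^(-1/2)), and J = sqrt k -> oo gives
   P(Z = oo) = 0. *)
Require Import Defs.
From HB Require Import structures.
From mathcomp Require Import all_boot all_order all_algebra.
From mathcomp Require Import all_classical all_reals all_analysis.
From mathcomp Require Import ring lra.
Import Order.TTheory GRing.Theory Num.Theory.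
Import numFieldNormedType.Exports.
Local Open Scope classical_set_scope.
Local Open Scope ring_scope.

(** * Expectations, Markov's inequality and the one-step drop of a truncated mean *)

Section expectation.
Context {d} {T : measurableType d} {R : realType} {P : probability T R}.
Implicit Types (A B : set T) (f g : T -> R).

Lemma le_fine_probability {A B} : measurable A -> measurable B -> A `<=` B ->
  fine (P A) <= fine (P B).
Proof.
move=> mA mB AB; apply: fine_le; rewrite ?fin_num_measure//.
by apply: le_measure; rewrite ?inE.
Qed.

Lemma fine_probabilityU {A B} : measurable A -> measurable B ->
  fine (P (A `|` B)) <= fine (P A) + fine (P B).
Proof.
move=> mA mB; rewrite -fineD ?fin_num_measure//.
apply: fine_le; rewrite ?fin_numD ?fin_num_measure//; first exact: measurableU.
exact: measureU2.
Qed.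

Lemma Rintegral_indic A : measurable A -> \int[P]_w \1_A w = fine (P A).
Proof. by move=> mA; rewrite /Rintegral integral_indic// setIT. Qed.

Lemma integrable_indicEFin A : measurable A ->
  P.-integrable setT (EFin \o (\1_A : T -> R)).
Proof. exact: integrable_indic. Qed.

Lemma integrable_patch f A : measurable A ->
  P.-integrable setT (EFin \o f) -> P.-integrable setT (EFin \o (f \_ A)).
Proof.
move=> mA fi; rewrite -restrict_EFin; apply: (integrable_mkcond _ mA).1.
exact: integrableS fi.
Qed.

Lemma integrable_addr {A f g} : measurable A -> P.-integrable A (EFin \o f) ->
  P.-integrable A (EFin \o g) -> P.-integrable A (EFin \o (fun w => f w + g w)).
Proof. by move=> mA fi gi; exact: (integrableD mA fi gi). Qed.

Lemma integrable_subr {A f g} : measurable A -> P.-integrable A (EFin \o f) ->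
  P.-integrable A (EFin \o g) -> P.-integrable A (EFin \o (fun w => f w - g w)).
Proof. by move=> mA fi gi; exact: (integrableB mA fi gi). Qed.

Lemma integrable_mull {A f} (r : R) : measurable A ->
  P.-integrable A (EFin \o f) -> P.-integrable A (EFin \o (fun w => r * f w)).
Proof. by move=> mA fi; exact: (integrableZl mA r fi). Qed.

Lemma integrable_max f g : P.-integrable setT (EFin \o f) ->
  P.-integrable setT (EFin \o g) ->
  P.-integrable setT (EFin \o (fun w => Num.max (f w) (g w))).
Proof.
move=> fi gi.
have -> : EFin \o (fun w => Num.max (f w) (g w)) =
    EFin \o (fun w => 2^-1 * (f w + g w + `|f w - g w|)).
  by apply/funext => w /=; congr EFin; rewrite maxr_absE; lra.
apply: integrable_mull => //; apply: integrable_addr => //.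
  exact: integrable_addr.
exact: integrable_norm (integrable_subr measurableT fi gi).
Qed.

Lemma integrable_min_cst f (t : R) : P.-integrable setT (EFin \o f) ->
  P.-integrable setT (EFin \o (fun w => Num.min (f w) t)).
Proof.
move=> fi.
have ti : P.-integrable setT (EFin \o cst t).
  exact: finite_measure_integrable_cst.
have -> : EFin \o (fun w => Num.min (f w) t) =
    EFin \o (fun w => f w + t - Num.max (f w) t).
  by apply/funext => w /=; congr EFin; rewrite -(addr_max_min (f w) t); lra.
apply: integrable_subr => //; first exact: integrable_addr.
exact: integrable_max.
Qed.

(** Almost surely [g] equals the maximum of [f] and [g], which dominates [f] at every point, so
    monotonicity under a pointwise bound applies. *)
Lemma ae_le_Rintegral A f g : measurable A ->
  P.-integrable setT (EFin \o f) -> P.-integrable setT (EFin \o g) ->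
  {ae P, forall w, f w <= g w} ->
  \int[P]_(w in A) f w <= \int[P]_(w in A) g w.
Proof.
move=> mA fi gi fg; have mi := integrable_max _ _ fi gi.
have -> : \int[P]_(w in A) g w = \int[P]_(w in A) Num.max (f w) (g w).
  congr fine; apply: ae_eq_integral => //.
  - by apply: measurable_funS (measurable_int P gi).
  - by apply: measurable_funS (measurable_int P mi).
  - by apply: filterS fg => w fgw _; rewrite max_r.
apply: le_Rintegral => //.
- exact: integrableS fi.
- exact: integrableS mi.
- by move=> w _; rewrite le_max lexx.
Qed.

Lemma markov_Rintegral {f} {a : R} : measurable [set w | a <= f w] ->
  P.-integrable setT (EFin \o f) -> (forall w, 0 <= f w) ->
  a * fine (P [set w | a <= f w]) <= \int[P]_w f w.
Proof.
set B := [set w | _] => mB fi f0.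
rewrite -Rintegral_indic// -RintegralZl//; last exact: integrable_indicEFin.
apply: le_Rintegral => //.
  by apply: integrable_mull => //; exact: integrable_indicEFin.
by move=> w _; rewrite indicE; case: (boolP (w \in B)) => [/set_mem|_];
  rewrite ?mulr1 ?mulr0.
Qed.

(* On A, (t - y)^+ >= (x - y)^+ - s, and the mean of (x - y)^+ is at least half
   the mean of |x - y|. *)
Lemma truncation_drop (x y : T -> R) (s t : R) A :
  P.-integrable setT (EFin \o x) ->
  P.-integrable setT (EFin \o y) ->
  measurable A -> (forall w, A w -> t <= x w < t + s) ->
  let C := [set w | x w < t] in measurable C ->
  \int[P]_(w in C) y w <= \int[P]_(w in C) x w ->
  \int[P]_(w in A) y w <= \int[P]_(w in A) x w ->
  4 * s * fine (P A) <= \int[P]_(w in A) `|y w - x w| ->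
  \int[P]_w Num.min (y w) t + s * fine (P A) <= \int[P]_w Num.min (x w) t.
Proof.
move=> xi yi mA Ax C mC yxC yxA sA.
have yxi := integrable_subr measurableT yi xi.
have ni := integrable_norm yxi.
have iS (B : set T) f : measurable B -> P.-integrable setT (EFin \o f) ->
    P.-integrable B (EFin \o f) by move=> mB; exact: integrableS.
have eC : \int[P]_w ((fun w => y w - x w) \_ C) w <= 0.
  by rewrite -Rintegral_mkcond RintegralB ?subr_le0//; exact: iS.
have eA : \int[P]_w ((fun w => y w - x w) \_ A) w <= 0.
  by rewrite -Rintegral_mkcond RintegralB ?subr_le0//; exact: iS.
move: sA; rewrite [leRHS]Rintegral_mkcond => sA.
have iC := integrable_patch _ _ mC yxi.
have iA := integrable_patch _ _ mA yxi.
have iN := integrable_patch _ _ mA ni.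
have iI := integrable_indicEFin _ mA.
(* The sets [C] and [A] are disjoint. On [C], min(y, t) <= y = x + (y - x). On [A], min(x, t) = t
   and (|y - x| - (y - x)) / 2 = (x - y)^+ <= (t - y)^+ + s. Elsewhere min(y, t) <= t = min(x,
   t). *)
have : \int[P]_w (Num.min (y w) t + 2^-1 * ((fun w => `|y w - x w|) \_ A) w) <=
  \int[P]_w (Num.min (x w) t + ((fun w => y w - x w) \_ C) w +
     2^-1 * ((fun w => y w - x w) \_ A) w + s * \1_A w).
  apply: le_Rintegral => //.
  - apply: integrable_addr => //; first exact: integrable_min_cst.
    exact: integrable_mull.
  - repeat apply: integrable_addr => //; try exact: integrable_mull.
    exact: integrable_min_cst.
  (* Off its set a restricted function takes the default value [point], which is 0 in [R]. *)
  move=> w _; rewrite !patchE indicE (_ : point = 0 :> R)//.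
  have -> : (w \in C) = (x w < t) by apply/idP/idP => [/set_mem|/mem_set].
  case: (boolP (w \in A)) => [/set_mem/Ax/andP[tx xs]|_] /=.
    rewrite ltNge tx /= (min_r tx) mulr1.
    by case: ger0P => ?; case: (lerP (y w) t) => ?; lra.
  by case: (ltrP (x w) t) => ?; case: (lerP (y w) t) => ?; lra.
rewrite !(RintegralD, RintegralZl)//; last first.
all: try by repeat apply: integrable_addr => //; try exact: integrable_mull;
    exact: integrable_min_cst.
rewrite Rintegral_indic//.
(* Half of the bound [4 * s * fine (P A)] is 2 s P(A); the error term on [A] costs s P(A), and s
   P(A) remains. *)
lra.
Qed.

End expectation.

(** * Time spent by the supermartingale in bands of width [s] *)

Section supermartingale.
Context {d} {T : measurableType d} {R : realType} {P : probability T R}.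
Context {F : nat -> set (set T)} {X : nat -> {RV P >-> R}} {delta : R}.
Hypothesis F_filtration : filtration F.
Hypothesis X_supermartingale : supermartingale F X.
Hypothesis X_ge0 : forall n w, 0 <= X n w.
Hypothesis delta_gt0 : 0 < delta.
Hypothesis X_diff : forall n, exists2 Y : T -> R,
  is_cond_exp P (F n) (fun w => `|X n.+1 w - X n w|) Y &
  {ae P, forall w, delta * \1_[set v | 0 < X n v] w <= Y w}.

Let s := delta / 4.
Let s_gt0 : 0 < s. Proof. by rewrite divr_gt0. Qed.

(** The positivity clause keeps the zero set out of the bottom band [t = 0]: the increments are
    bounded below only where [X n] is positive. *)
Definition band n (t : R) := [set w | 0 < X n w /\ t <= X n w < t + s].

Lemma filtration_measurable n A : F n A -> measurable A.
Proof. by case: F_filtration => _ + _; exact. Qed.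

Lemma filtration_preimage n (B : set R) : measurable B -> F n (X n @^-1` B).
Proof.
case: X_supermartingale => mX _ _ mB; apply: (mX n).
by exists B => //; rewrite setTI.
Qed.

Lemma measurable_preimage n (B : set R) : measurable B ->
  measurable (X n @^-1` B).
Proof. by move=> /filtration_preimage/filtration_measurable. Qed.

Lemma measurable_pos n : measurable [set w | 0 < X n w].
Proof.
rewrite (_ : [set w | _] = X n @^-1` `]0, +oo[%classic).
  exact: measurable_preimage.
by apply/seteqP; split => w /=; rewrite in_itv/= andbT.
Qed.

Lemma filtration_lt n (t : R) : F n [set w | X n w < t].
Proof.
rewrite (_ : [set w | _] = X n @^-1` `]-oo, t[%classic).
  exact: filtration_preimage.
by apply/seteqP; split => w /=; rewrite in_itv.
Qed.

Lemma measurable_ge n (t : R) : measurable [set w | t <= X n w].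
Proof.
rewrite (_ : [set w | _] = X n @^-1` `[t, +oo[%classic).
  exact: measurable_preimage.
by apply/seteqP; split => w /=; rewrite in_itv/= andbT.
Qed.

Lemma filtration_band n t : F n (band n t).
Proof.
rewrite (_ : band n t =
    X n @^-1` (`]0, +oo[%classic `&` `[t, t + s[%classic)).
  by apply: filtration_preimage; exact: measurableI.
by apply/seteqP; split => w; rewrite /band /= !in_itv/= andbT.
Qed.

Lemma measurable_band n t : measurable (band n t).
Proof. exact: filtration_measurable (filtration_band n t). Qed.

Lemma integrable_X n : P.-integrable setT (EFin \o X n).
Proof. by case: X_supermartingale => _ + _; exact. Qed.

Lemma supermartingale_le_Rintegral n A : F n A ->
  \int[P]_(w in A) X n.+1 w <= \int[P]_(w in A) X n w.
Proof.
move=> FA; case: X_supermartingale => _ _ /(_ n)[Y [mY Yi eY] YX].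
rewrite /Rintegral -(eY _ FA); apply: ae_le_Rintegral => //.
- exact: filtration_measurable FA.
- exact: integrable_X.
Qed.

Lemma Rintegral_X_le n : \int[P]_w X n w <= \int[P]_w X 0%N w.
Proof.
elim: n => // n; apply: le_trans; apply: supermartingale_le_Rintegral.
by rewrite -(preimage_setT (X n)); exact: filtration_preimage.
Qed.

(** Both the band and the set where [X n] is below [t] lie in [F n], so the two conditional
    hypotheses can be integrated over them and fed to [truncation_drop]. *)
Lemma band_drop n t :
  \int[P]_w Num.min (X n.+1 w) t + s * fine (P (band n t)) <=
  \int[P]_w Num.min (X n w) t.
Proof.
have mA := measurable_band n t.
apply: truncation_drop => //; try exact: integrable_X.
- by move=> w [].
- exact: filtration_measurable (filtration_lt n t).
- exact: supermartingale_le_Rintegral (filtration_lt n t).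
- exact: supermartingale_le_Rintegral (filtration_band n t).
have [Y [mY Yi eY] dY] := X_diff n.
rewrite [leRHS]/Rintegral -(eY _ (filtration_band n t)).
rewrite (_ : 4 * s = delta); last by rewrite /s mulrC divfK.
rewrite -Rintegral_cst//.
have -> : \int[P]_(_ in band n t) delta =
    \int[P]_(w in band n t) (delta * \1_[set v | 0 < X n v] w).
  apply: eq_Rintegral => w /set_mem[w0 _].
  by rewrite indicE mem_set// mulr1.
apply: ae_le_Rintegral => //.
by apply: integrable_mull => //; apply: integrable_indicEFin; exact: measurable_pos.
Qed.

(** The drops of the truncated means telescope. As [0 <= t], these means stay nonnegative, so the
    total drop is at most the initial mean, uniformly in [N]. *)
Lemma sum_band_le N t : 0 <= t ->
  s * \sum_(n < N) fine (P (band n t)) <= \int[P]_w X 0%N w.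
Proof.
move=> t0.
have H : \int[P]_w Num.min (X N w) t + s * \sum_(n < N) fine (P (band n t)) <=
    \int[P]_w Num.min (X 0%N w) t.
  elim: N => [|N IH]; first by rewrite big_ord0 mulr0 addr0.
  by rewrite big_ord_recr/=; have := band_drop N t; lra.
have h0 : 0 <= \int[P]_w Num.min (X N w) t.
  by apply: Rintegral_ge0 => w _; rewrite le_min X_ge0.
have h1 : \int[P]_w Num.min (X 0%N w) t <= \int[P]_w X 0%N w.
  apply: le_Rintegral => //; try exact: integrable_X.
    by apply: integrable_min_cst; exact: integrable_X.
  by move=> w _; rewrite ge_min lexx.
lra.
Qed.

Lemma prob_pos_le n J :
  fine (P [set w | 0 < X n w]) <=
  fine (P [set w | J%:R * s <= X n w]) +
  \sum_(j < J) fine (P (band n (j%:R * s))).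
Proof.
(* With positivity kept in [U], [U 0] is the whole event to be covered, and what [U J] loses on
   passing to [U J.+1] lies in one band. *)
pose U i := [set w | 0 < X n w] `&` [set w | i%:R * s <= X n w].
have mU i : measurable (U i).
  by apply: measurableI; [exact: measurable_pos|exact: measurable_ge].
suff H : fine (P [set w | 0 < X n w]) <=
    fine (P (U J)) + \sum_(j < J) fine (P (band n (j%:R * s))).
  apply: le_trans H _; rewrite lerD2r; apply: le_fine_probability => //.
  - exact: measurable_ge.
  - by move=> w [].
elim: J => [|J IH].
  rewrite big_ord0 addr0; apply: le_fine_probability => //.
    exact: measurable_pos.
  by move=> w w0; split => //=; rewrite mul0r X_ge0.
rewrite big_ord_recr/=.
suff : fine (P (U J)) <= fine (P (U J.+1)) + fine (P (band n (J%:R * s))).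
  lra.
apply: le_trans _ (fine_probabilityU (mU J.+1) (measurable_band n (J%:R * s))).
apply: le_fine_probability => //.
  by apply: measurableU => //; exact: measurable_band.
move=> w [w0 wJ]; have [h|h] := leP (J.+1%:R * s) (X n w); [left|right] => //.
by split => //; rewrite wJ/=; move: h; rewrite -natr1 mulrDl mul1r.
Qed.

Lemma measurable_survival k :
  measurable [set w | forall n, (n < k)%N -> 0 < X n w].
Proof.
rewrite (_ : [set w | _] = \bigcap_(n < k) [set w | 0 < X n w])//.
by apply: bigcap_measurableType => n _; exact: measurable_pos.
Qed.

Lemma prob_survival_le k J : (0 < k)%N -> (0 < J)%N ->
  fine (P [set w | forall n, (n < k)%N -> 0 < X n w]) <=
  \int[P]_w X 0%N w / s * (J%:R^-1 + J%:R / k%:R).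
Proof.
move=> k0 J0; set S := [set w | _]; set c := \int[P]_w X 0%N w.
have mS : measurable S by exact: measurable_survival.
have kR : 0 < k%:R :> R by rewrite ltr0n.
have JR : 0 < J%:R :> R by rewrite ltr0n.
(* Survival forces positivity at each time [n < k], so the same probability is bounded [k] times,
   once per time. *)
have hS (n : 'I_k) : fine (P S) <= c / (J%:R * s) +
    \sum_(j < J) fine (P (band n (j%:R * s))).
  apply: le_trans (le_fine_probability mS (measurable_pos n) _) _.
    by move=> w; apply.
  apply: le_trans (prob_pos_le n J) _; rewrite lerD2r.
  rewrite ler_pdivlMr ?mulr_gt0// mulrC.
  apply: le_trans (markov_Rintegral _ _ _) _ => //.
  - exact: measurable_ge.
  - exact: integrable_X.
  - exact: Rintegral_X_le.
have : \sum_(n < k) fine (P S) <= \sum_(n < k) (c / (J%:R * s) +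
    \sum_(j < J) fine (P (band n (j%:R * s)))).
  by apply: ler_sum => n _; exact: hS.
(* Summing over time first bounds each band's contribution by [c / s], whatever [k] is. *)
rewrite big_split/= !sumr_const !card_ord exchange_big/=.
have : \sum_(j < J) \sum_(n < k) fine (P (band n (j%:R * s))) <=
    \sum_(j < J) (c / s).
  apply: ler_sum => j _; rewrite ler_pdivlMr// mulrC.
  by apply: sum_band_le; rewrite mulr_ge0// ltW.
rewrite sumr_const card_ord -[_ *+ J]mulr_natl => h1.
rewrite -[fine _ *+ k]mulr_natl -[_ / _ *+ k]mulr_natl => h2.
rewrite -(ler_pM2l kR).
apply: le_trans h2 (le_trans (lerD (lexx _) h1) _).
rewrite (_ : k%:R * (c / s * _) = k%:R * (c / (J%:R * s)) + J%:R * (c / s))//.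
by field; rewrite !gt_eqF.
Qed.
End supermartingale.

(** * Tails of the hitting time and the choice of [J] *)

Lemma le_stopping_time_Z d (T : measurableType d) (R : realType)
    (P : probability T R) (X : nat -> {RV P >-> R}) (k : nat) :
  [set w | (k%:R%:E <= stopping_time_Z X w)%E] =
  [set w | forall n, (n < k)%N -> 0 < X n w].
Proof.
apply/seteqP; split => w /=; rewrite /stopping_time_Z; case: pselect => [h|h].
- rewrite lee_fin ler_nat; case: ex_minnP => m _ hm km n nk.
  by rewrite ltNge; apply: contraL nk => /hm mn; rewrite -leqNgt (leq_trans km).
- by move=> _ n _; rewrite ltNge; apply/negP => Xn; apply: h; exists n.
- rewrite lee_fin ler_nat; case: ex_minnP => m Xm _ hk.
  by rewrite leqNgt; apply/negP => /hk; rewrite ltNge Xm.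
- by rewrite leey.
Qed.

(** For r = sqrt k >= 1 one has r < J <= r + 1 <= 2 r, so the left side is at most 1 / r + 2 r / k =
    3 / r. Since k >= 1, the exponent -1/2 may be weakened to -1/6. *)
Lemma sqrt_succ_truncn_le (R : realType) (k : nat) : (0 < k)%N ->
  let J := (Num.truncn (Num.sqrt k%:R : R)).+1 in
  (J%:R^-1 + J%:R / k%:R : R) <= 3 * k%:R `^ (- (1 / 6)).
Proof.
move=> k0; cbv zeta; set r : R := Num.sqrt k%:R.
set J := (Num.truncn r).+1.
have k1 : 1 <= k%:R :> R by rewrite ler1n.
have r1 : 1 <= r by rewrite -sqrtr1 ler_wsqrtr.
have r0 : 0 < r by exact: lt_le_trans r1.
have rJ : r < J%:R by exact: truncnS_gt.
have Jr : J%:R <= r + 1 by rewrite -natr1 lerD2r truncn_le ltW.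
have rk : k%:R = r * r by rewrite -expr2 sqr_sqrtr.
apply: (@le_trans _ _ (3 * r^-1)).
  have -> : 3 * r^-1 = r^-1 + 2 * r / k%:R.
    by rewrite rk; field; rewrite gt_eqF.
  apply: lerD; first by rewrite lef_pV2 ?posrE ?ltr0n// ltW.
  by rewrite ler_pM2r ?invr_gt0 ?ltr0n//; lra.
rewrite ler_pM2l// /r -powR12_sqrt// -powRN.
by apply: ler_powR => //; lra.
Qed.

Theorem theorem6 (d : measure_display) (T : measurableType d) (R : realType)
    (P : probability T R) (F : nat -> set (set T)) (X : nat -> {RV P >-> R})
    (hF : filtration F)
    (hX : supermartingale F X)
    (hX0 : exists c : R, forall w, X 0%N w = c)
    (hX_ge0 : forall n w, 0 <= X n w)
    (hX_absorb : forall n w, X n w = 0 -> X n.+1 w = 0)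
    (hX_diff : exists2 delta : R, 0 < delta &
       forall n, exists2 Y : T -> R,
         is_cond_exp P (F n) (fun w => `|X n.+1 w - X n w|) Y &
         {ae P, forall w, delta * \1_[set v | 0 < X n v] w <= Y w}) :
  P [set w | (stopping_time_Z X w < +oo)%E] = 1%E /\
  (fun k : nat => fine (P [set w | (k%:R%:E <= stopping_time_Z X w)%E]))
    =O_\oo (fun k : nat => k%:R `^ (- (1 / 6)) : R).
Proof.
have [delta delta_gt0 hY] := hX_diff.
set c := \int[P]_w X 0%N w.
have c0 : 0 <= c by apply: Rintegral_ge0 => w _.
set C := c / (delta / 4) * 3.
have C0 : 0 <= C by rewrite mulr_ge0// divr_ge0// divr_ge0// ltW.
have mS k : measurable [set w | (k%:R%:E <= stopping_time_Z X w)%E].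
  rewrite le_stopping_time_Z.
  exact: (measurable_survival hF hX).
have survival_le k : (0 < k)%N ->
    fine (P [set w | (k%:R%:E <= stopping_time_Z X w)%E]) <=
    C * k%:R `^ (- (1 / 6)).
  move=> k0; rewrite le_stopping_time_Z.
  apply: le_trans (prob_survival_le hF hX hX_ge0 delta_gt0 hY _ _ k0 (ltn0Sn _)) _.
  rewrite /C -[leRHS]mulrA ler_wpM2l//; first by rewrite divr_ge0// divr_ge0// ltW.
  exact: sqrt_succ_truncn_le.
split; last first.
  (* The witness must be strictly positive, whereas [C] vanishes when [c] does. *)
  apply/eqO_exP; exists (C + 1); first by rewrite ltr_wpDl.
  near=> k.
  have k0 : (0 < k)%N by near: k; exists 1%N.
  rewrite !ger0_norm ?powR_ge0 ?fine_ge0//.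
  apply: le_trans (survival_le k k0) _.
  by rewrite ler_wpM2r ?powR_ge0// lerDl.
set N := \bigcap_k [set w | (k%:R%:E <= stopping_time_Z X w)%E].
have mN : measurable N by exact: bigcapT_measurable.
have -> : [set w | (stopping_time_Z X w < +oo)%E] = ~` N.
  apply/seteqP; split => w /=.
    move=> wy Nw; have := fun k => Nw k I; move: wy.
    (* A finite hitting time does not reach its own successor. *)
    rewrite /stopping_time_Z /=; case: pselect => // h _ /(_ (ex_minn h).+1).
    by rewrite lee_fin ler_nat ltnn.
  move=> Nw; rewrite ltNge; apply/negP; rewrite leye_eq => /eqP wy.
  by apply: Nw => k _ /=; rewrite wy leey.
rewrite probability_setC// (_ : P N = 0%E) ?sube0//.
rewrite -[LHS]fineK ?fin_num_measure//; congr EFin.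
apply/eqP; rewrite eq_le fine_ge0// andbT leNgt; apply/negP => N_gt0.
(* With [k = J * J] the survival bound is [b / J%:R]. If [N] had positive probability, taking [J]
   above [b / fine (P N)] would contradict it. *)
set b := c / (delta / 4) * 2.
have := truncnS_gt (b / fine (P N)); set J := (Num.truncn _).+1.
rewrite ltr_pdivrMr// ltNge => /negP; apply.
have : fine (P N) <= c / (delta / 4) * (J%:R^-1 + J%:R / (J * J)%N%:R).
  apply: le_trans (prob_survival_le hF hX hX_ge0 delta_gt0 hY _ J _ _) => //.
  apply: le_fine_probability => //.
    exact: (measurable_survival hF hX).
  by rewrite -le_stopping_time_Z => w; exact.
have J0 : 0 < J%:R :> R by rewrite ltr0n.
rewrite (_ : _ * (_ + _) = b / J%:R); last first.
  by rewrite natrM /b; field; rewrite !gt_eqF.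
by rewrite ler_pdivlMr// mulrC.
Unshelve. all: by end_near.
Qed.
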